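(* Let $X$ be a set and let $K:X\times X\to[0,\infty)$ be a symmetric function (i.e. $K(x,y)=K(y,x)$ for all $x,y\in X$) satisfying (a) $K(x,x)=\sup_{y\in X}K(x,y)$ for every $x\in X$; (b) $0<\Lambda_\infty\le\infty$, where $\Lambda_\infty=\sup\{\alpha>0:\ \{K>\alpha\}^{(m)}=X\times X\text{ for some positive integer }m\}$. Let $0<\Lambda<\Lambda_\infty$, let $k\ge 1$ be an integer, and let $0=\lambda(0)<\lambda(1)<\dots<\lambda(k)=\Lambda$ be any finite sequence such that $\{K>\lambda(i)\}^{(3)}\subseteq\{K>\lambda(i-1)\}$ for every $i=1,\dots,k$, and $\triangle\subset\{K>\lambda(i)\}$ for every $i=0,1,\dots,k$. Then there exists a pseudo-metric $d_\lambda$ on $X$ such that: (1) $\{K>\lambda(i)\}\subseteq\{d_\lambda<2^{-i}\}\subseteq\{K>\lambda(i-1)\}$ for every $i=1,2,\dots,k$; (2) for every strictly increasing function $\lambda:[0,k]\to[0,\Lambda]$ extending the sequence $\lambda(0),\dots,\lambda(k)$, with inverse $\lambda^{-1}:\lambda([0,k])\to[0,k]$, the function $\delta_\lambda=2^{-\lambda^{-1}\circ K}$ satisfies $$\frac{\delta_\lambda(x,y)}{4}<d_\lambda(x,y)\le 2\,\delta_\lambda(x,y)$$ for all $(x,y)\in X\times X$ at which $\delta_\lambda$ is defined, i.e. for which $K(x,y)\in\lambda([0,k])$.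
   Context: For $\alpha\ge 0$, $\{K>\alpha\}$ denotes $\{(x,y)\in X\times X: K(x,y)>\alpha\}$; similarly $\{d_\lambda<r\}=\{(x,y)\in X\times X: d_\lambda(x,y)<r\}$. The diagonal is $\triangle=\{(x,x):x\in X\}$. For $U,V\subseteq X\times X$, the composition is $V\circ U=\{(x,z)\in X\times X:\text{ there exists }y\in X\text{ with }(x,y)\in U\text{ and }(y,z)\in V\}$, and $V^{(n)}=V\circ V\circ\cdots\circ V$ ($n$ factors). A pseudo-metric on $X$ is a function $d:X\times X\to[0,\infty)$ with $d(x,x)=0$, $d(x,y)=d(y,x)$ and $d(x,z)\le d(x,y)+d(y,z)$ for all $x,y,z\in X$. *)

(* Defs.v *)
From HB Require Import structures.
From mathcomp Require Import all_boot all_order all_algebra.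
From mathcomp Require Import all_classical all_reals all_analysis.
Set Implicit Arguments.
Unset Strict Implicit.
Unset Printing Implicit Defensive.
Import Order.TTheory GRing.Theory Num.Theory.
Import numFieldNormedType.Exports.
Local Open Scope classical_set_scope.
Local Open Scope ring_scope.

Definition superlevel (R : realType) (X : Type) (K : X * X -> R) (a : R) :
  set (X * X) := [set p | a < K p].

Definition sublevel (R : realType) (X : Type) (d : X * X -> R) (r : R) :
  set (X * X) := [set p | d p < r].

(* The library's [V \; U] is [V] after [U]: it relates x to z when U (x, y) and
   V (y, z) for some y. [comp_power V m] has m factors, so it is meaningful only
   for 0 < m; its value at m = 0 is the junk value [V]. *)
Definition comp_power (X : Type) (V : set (X * X)) (m : nat) : set (X * X) :=
  iter m.-1 (fun W : set (X * X) => V \; W)%relation V.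

(* The supremum is taken in the extended reals; it is -oo when no such a
   exists and +oo when the set is unbounded. *)
Definition Lambda_infty (R : realType) (X : Type) (K : X * X -> R) : \bar R :=
  ereal_sup [set a%:E | a in
    [set a : R | 0 < a /\
       exists m : nat, (0 < m)%N /\ comp_power (superlevel K a) m = setT]].

Definition pseudo_metric (R : realType) (X : Type) (d : X * X -> R) : Prop :=
  [/\ forall x y, 0 <= d (x, y),
      forall x, d (x, x) = 0,
      forall x y, d (x, y) = d (y, x) &
      forall x y z, d (x, z) <= d (x, y) + d (y, z)].

(* 2 to the power - f^-1 (K p), with f^-1 the inverse of f restricted to
   [0, k]; meaningful only where K p lies in f([0, k]) and f is injective on
   [0, k]. *)
Definition delta (R : realType) (X : Type) (K : X * X -> R) (k : nat)
    (f : R -> R) (p : X * X) : R :=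
  2 `^ (- 'pinv_(fun=> 0) `[0, k%:R] f (K p)).

(* Main.v *)
Require Import Defs.
From HB Require Import structures.
From mathcomp Require Import all_boot all_order all_algebra.
From mathcomp Require Import all_classical all_reals all_analysis.
From mathcomp Require Import lra.
Set Implicit Arguments.
Unset Strict Implicit.
Unset Printing Implicit Defensive.
Import Order.TTheory GRing.Theory Num.Theory.
Import numFieldNormedType.Exports.
Local Open Scope classical_set_scope.
Local Open Scope ring_scope.

(** The theorem is a finite version of the metrization lemma for uniform
    spaces.  Write [U i] for the superlevel set of [K] at height [lam i]; these
    are symmetric, contain the diagonal, and the threefold composite of
    [U i.+1] lies in [U i].  Give a pair of distinct points the cost [2 ^- i],
    where [i] is the least index such that the pair lies outside [U i], and the
    cost [2 ^- k.+1] if it lies in every [U i] ([dyadic_cost]).  The composition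
    hypothesis says exactly that a chain of three steps, each of cost at most
    [a], joins points whose cost is at most [2 * a].  For every such cost the
    infimum of the lengths of chains from one point to another is a
    pseudo-metric, and splitting a chain at half of its length shows by
    induction that it loses at most a factor 2 with respect to the cost
    ([cost_le_double_path_length]).  This gives ([finite_metrization])
    a pseudo-metric [d <= 1] with [d <= 2 ^- i.+1] on [U i] and
    [2 ^- i.+1 <= d] off [U i].

    If [K (x, y) = f t] with [i < t <= i + 1], then [(x, y)] lies in [U i] but
    not in [U i.+1], so [2 ^- i.+2 <= d (x, y) <= 2 ^- i.+1], while
    [2 ^- i.+1 <= delta < 2 ^- i] for [delta = 2 `^ (- t)]; the bounds on
    [d / delta] follow, the lower one being strict because [delta < 2 ^- i] is.  When [t = 0] the pair lies outside [U 0], and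
    [1 / 2 <= d <= 1] is enough. *)

(** * Chains and the chain pseudo-metric *)

Fixpoint path_length (R : realType) (X : Type) (g : X * X -> R) (x : X)
    (s : seq X) : R :=
  if s is y :: s' then g (x, y) + path_length g y s' else 0.

Definition chain_dist (R : realType) (X : Type) (g : X * X -> R) (p : X * X) :=
  inf [set path_length g p.1 s | s in [set s | last p.1 s = p.2]].

Lemma path_length_ge0 (R : realType) (X : Type) (g : X * X -> R)
    (g_ge0 : forall p, 0 <= g p) x s :
  0 <= path_length g x s.
Proof. by elim: s x => //= y s IHs x; rewrite addr_ge0. Qed.

Lemma path_length_cat (R : realType) (X : Type) (g : X * X -> R) x s t :
  path_length g x (s ++ t) = path_length g x s + path_length g (last x s) t.
Proof. by elim: s x => [|y s IHs] x /=; rewrite ?add0r // IHs addrA. Qed.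

Lemma last_rev_belast (X : Type) (x : X) s :
  last (last x s) (rev (belast x s)) = x.
Proof. by case: s => [|y s] //=; rewrite rev_cons last_rcons. Qed.

Lemma path_length_rev (R : realType) (X : Type) (g : X * X -> R)
    (g_sym : forall x y, g (x, y) = g (y, x)) x s :
  path_length g (last x s) (rev (belast x s)) = path_length g x s.
Proof.
elim: s x => [|y s IHs] x //=.
rewrite rev_cons -cats1 path_length_cat IHs last_rev_belast /= addr0 g_sym.
exact: addrC.
Qed.

(** The step [u -> v] is the one during which the length passes [c].  Both
    inequalities are weak because a chain of length 0, with [c = 0], has to
    split as well. *)
Lemma path_length_split (R : realType) (X : Type) (g : X * X -> R) c x y s :
  0 <= c -> c <= path_length g x (y :: s) ->
  exists s1 v s2, [/\ y :: s = s1 ++ v :: s2, path_length g x s1 <= c &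
                      c <= path_length g x s1 + g (last x s1, v)].
Proof.
elim: s x y c => [|z s IHs] x y c c_ge0 /= c_le.
  by exists [::], y, [::]; split => //=; lra.
have [c_le_g|g_lt_c] := leP c (g (x, y)).
  by exists [::], y, (z :: s); split => //=; lra.
have [||s1 [v [s2 [-> le_c c_le']]]] := IHs y z (c - g (x, y)).
- lra.
- by move: c_le => /=; lra.
by exists (y :: s1), v, s2; split => //=; lra.
Qed.

(** A chain of length [a] is cut into a piece of length at most [a / 2], one
    step, and another piece of length at most [a / 2].  By induction the end
    points of the three parts have cost at most [a], and [g_three] gives the
    cost [2 * a] for the whole chain: the constant 2 reproduces itself, so it
    does not depend on the number of steps. *)
Lemma cost_le_double_path_length (R : realType) (X : Type) (g : X * X -> R)
    (g_ge0 : forall p, 0 <= g p) (g_diag : forall x, g (x, x) = 0)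
    (g_three : forall x y z w a,
       g (x, y) <= a -> g (y, z) <= a -> g (z, w) <= a -> g (x, w) <= 2 * a)
    x s :
  g (x, last x s) <= 2 * path_length g x s.
Proof.
have [n] := ubnP (size s); elim: n x s => // n IHn x [|y s] size_s.
  by rewrite /= g_diag mulr0.
have a_ge0 := path_length_ge0 g_ge0 x (y :: s).
set a := path_length g x (y :: s) in a_ge0 *.
have [||s1 [v [s2 [s_eq s1_le le_s1]]]] := @path_length_split _ _ g (a / 2) x y s.
- lra.
- by rewrite -/a; lra.
have sizes : (size s1 + size s2 < n)%N.
  by move: size_s; rewrite s_eq size_cat /= addnS ltnS.
have a_eq : a = path_length g x s1 + (g (last x s1, v) + path_length g v s2).
  by rewrite /a s_eq path_length_cat.
have IH1 := IHn x s1 (leq_ltn_trans (leq_addr _ _) sizes).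
have IH2 := IHn v s2 (leq_ltn_trans (leq_addl _ _) sizes).
have s1_ge0 := path_length_ge0 g_ge0 x s1.
have s2_ge0 := path_length_ge0 g_ge0 v s2.
rewrite s_eq last_cat /=.
by apply: (g_three x (last x s1) v (last v s2)); lra.
Qed.

Lemma chain_dist_le (R : realType) (X : Type) (g : X * X -> R)
    (g_ge0 : forall p, 0 <= g p) x s :
  chain_dist g (x, last x s) <= path_length g x s.
Proof.
apply: ge_inf; last by exists s.
by exists 0 => _ [t _ <-]; exact: path_length_ge0.
Qed.

Lemma le_chain_dist (R : realType) (X : Type) (g : X * X -> R) x y b :
  (forall s, last x s = y -> b <= path_length g x s) ->
  b <= chain_dist g (x, y).
Proof.
move=> b_le; apply: lb_le_inf; last by move=> _ [s /b_le ? <-].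
by exists (path_length g x [:: y]); exists [:: y].
Qed.

Lemma chain_dist_pseudo_metric (R : realType) (X : Type) (g : X * X -> R)
    (g_ge0 : forall p, 0 <= g p)
    (g_sym : forall x y, g (x, y) = g (y, x)) :
  pseudo_metric (chain_dist g).
Proof.
have d_ge0 x y : 0 <= chain_dist g (x, y).
  by apply: le_chain_dist => s _; exact: path_length_ge0.
have d_sym_le x y : chain_dist g (y, x) <= chain_dist g (x, y).
  apply: le_chain_dist => s <-.
  rewrite -(path_length_rev g_sym) -[X in (_, X)](last_rev_belast x s).
  exact: chain_dist_le.
split=> // [x|x y|x y z].
- by apply/eqP; rewrite eq_le d_ge0 andbT; exact: (chain_dist_le g_ge0 x [::]).
- by apply/eqP; rewrite eq_le !d_sym_le.
rewrite -lerBlDr; apply: le_chain_dist => s sy.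
rewrite lerBlDr addrC -lerBlDr; apply: le_chain_dist => t tz.
rewrite lerBlDr addrC -tz -sy -path_length_cat -last_cat.
exact: chain_dist_le.
Qed.

(** * Metrization of a finite sequence of entourages *)

(** On distinct points this is [2 ^- i] for the least [i <= n] such that [p] is
    outside [U i].  A pair of distinct points in every [U i] still needs a
    positive cost: [U n] is not assumed transitive, and if its pairs were free,
    chains inside [U n] could join points that are far apart at no cost. *)
Definition dyadic_cost (R : realType) (X : Type) (U : nat -> set (X * X))
    (n : nat) (p : X * X) : R :=
  if `[< p.1 = p.2 >] then 0 else
  \big[Num.max/2 ^- n.+1]_(i < n.+1 | `[< ~ U i p >]) 2 ^- i.

Lemma exp2V_le (R : realType) i j : (i <= j)%N -> (2 : R) ^- j <= 2 ^- i.
Proof. by move=> ij; rewrite lef_pV2 ?posrE ?exprn_gt0 // ler_eXn2l ?ltr1n. Qed.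

Lemma exp2V_double (R : realType) i : 2 * (2 : R) ^- i.+1 = 2 ^- i.
Proof. by rewrite exprS invfM mulrA divff ?mul1r ?pnatr_eq0. Qed.

Lemma exp2V_gt0 (R : realType) i : 0 < (2 : R) ^- i.
Proof. by rewrite invr_gt0 exprn_gt0. Qed.

Lemma comp_power3 (X : Type) (V : set (X * X)) x y z w :
  V (x, y) -> V (y, z) -> V (z, w) -> comp_power V 3 (x, w).
Proof. by move=> xy yz zw; exists z => //; exists y. Qed.

Lemma entourages_nested (X : Type) (U : nat -> set (X * X)) n
    (U_diag : forall i, (i <= n)%N -> diagonal `<=` U i)
    (U_comp : forall i, (i < n)%N -> comp_power (U i.+1) 3 `<=` U i) i j :
  (i <= j <= n)%N -> U j `<=` U i.
Proof.
move=> /andP[le_ij]; rewrite -(subnK le_ij).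
elim: (j - i)%N => [_ //|m IHm lt_n [x y] Uxy].
apply: IHm (ltnW lt_n) _ _; apply: U_comp => //.
by apply: (comp_power3 (y := x) (z := x)) => //; apply: U_diag.
Qed.

Lemma dyadic_cost_ge0 (R : realType) (X : Type) (U : nat -> set (X * X)) n p :
  0 <= dyadic_cost R U n p.
Proof.
rewrite /dyadic_cost; case: asboolP => // _.
by apply: le_trans (bigmax_ge_id _ _ _ _); exact/ltW/exp2V_gt0.
Qed.

Lemma dyadic_cost_sym (R : realType) (X : Type) (U : nat -> set (X * X)) n
    (U_sym : forall i x y, U i (x, y) -> U i (y, x)) x y :
  dyadic_cost R U n (x, y) = dyadic_cost R U n (y, x).
Proof.
rewrite /dyadic_cost /=.
have -> : `[< x = y >] = `[< y = x >] by apply: asbool_equiv_eq; split.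
case: asboolP => // _; apply: eq_bigl => i.
by apply: asbool_equiv_eq; split=> nU /U_sym.
Qed.

Lemma dyadic_cost_le (R : realType) (X : Type) (U : nat -> set (X * X)) n
    (U_diag : forall i, (i <= n)%N -> diagonal `<=` U i)
    (U_comp : forall i, (i < n)%N -> comp_power (U i.+1) 3 `<=` U i) i p :
  (i <= n)%N -> U i p -> dyadic_cost R U n p <= 2 ^- i.+1.
Proof.
move=> le_in Uip; rewrite /dyadic_cost; case: asboolP => _.
  exact/ltW/exp2V_gt0.
apply: bigmax_le => [|j /asboolP nUj]; apply: exp2V_le; first by rewrite ltnS.
rewrite ltnNge; apply/negP => le_ji; apply: nUj.
by move: Uip; apply: (entourages_nested U_diag U_comp); rewrite le_ji.
Qed.

Lemma dyadic_cost_lt (R : realType) (X : Type) (U : nat -> set (X * X)) n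
    (U_diag : forall i, (i <= n)%N -> diagonal `<=` U i) i p :
  (i <= n)%N -> dyadic_cost R U n p < 2 ^- i -> U i p.
Proof.
move=> le_in; rewrite /dyadic_cost; case: asboolP => [p_diag _|_].
  exact: U_diag.
rewrite -ltnS in le_in; apply: contraPP => nU; apply/negP; rewrite -leNgt.
exact: (le_bigmax_cond _ (fun j : 'I_n.+1 => 2 ^- j) (j := Ordinal le_in)
  (P := fun j : 'I_n.+1 => `[< ~ U j p >]) (asboolT nU)).
Qed.

(** If [a] is less than half of [2 ^- i], the three steps have cost below
    [2 ^- i.+1], hence lie in [U i.+1], and the composite lies in [U i], so
    [2 ^- i] does not occur in the cost of [(x, w)].  This needs [i < n]; the
    two remaining terms [2 ^- n] and [2 ^- n.+1] are at most [2 * a] as soon as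
    one of the steps is not trivial. *)
Lemma dyadic_cost_three (R : realType) (X : Type) (U : nat -> set (X * X)) n
    (U_diag : forall i, (i <= n)%N -> diagonal `<=` U i)
    (U_comp : forall i, (i < n)%N -> comp_power (U i.+1) 3 `<=` U i)
    x y z w a :
  dyadic_cost R U n (x, y) <= a -> dyadic_cost R U n (y, z) <= a ->
  dyadic_cost R U n (z, w) <= a -> dyadic_cost R U n (x, w) <= 2 * a.
Proof.
move=> xy yz zw.
have a_ge0 : 0 <= a := le_trans (dyadic_cost_ge0 _ _ _ _) xy.
have [a_lt|a_ge] := ltP a (2 ^- n.+1).
  (* Below the least positive cost every step stays in place. *)
  have step p : dyadic_cost R U n p <= a -> p.1 = p.2.
    rewrite /dyadic_cost; case: asboolP => // _ /le_lt_trans /(_ a_lt).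
    by rewrite ltNge bigmax_ge_id.
  have -> : (x, w) = (w, w).
    by rewrite (step _ xy : x = y) (step _ yz : y = z) (step _ zw : z = w).
  by rewrite /dyadic_cost asboolT // mulr_ge0.
rewrite {1}/dyadic_cost; case: asboolP => [_|_]; first by rewrite mulr_ge0.
apply: bigmax_le => [|[i le_in] /asboolP /= nUi]; first lra.
rewrite ltnS in le_in; rewrite -exp2V_double ler_pM2l // leNgt.
apply/negP => a_lt; case: (ltngtP i n) le_in => // [lt_in|eq_in] _.
  have step p : dyadic_cost R U n p <= a -> U i.+1 p.
    by move=> /le_lt_trans /(_ a_lt); exact: dyadic_cost_lt.
  apply: nUi; apply: U_comp => //.
  by apply: (comp_power3 (y := y) (z := z)); exact: step.
by move: a_lt; rewrite eq_in ltNge a_ge.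
Qed.

(** The constants are off by one from the usual [d < 2 ^- i]: the whole space
    acts as one more entourage before [U 0], and [d <= 1] is its bound. *)
Lemma finite_metrization (R : realType) (X : Type) (U : nat -> set (X * X)) n
    (U_sym : forall i x y, U i (x, y) -> U i (y, x))
    (U_diag : forall i, (i <= n)%N -> diagonal `<=` U i)
    (U_comp : forall i, (i < n)%N -> comp_power (U i.+1) 3 `<=` U i) :
  exists d : X * X -> R,
    [/\ pseudo_metric d, forall p, d p <= 1,
        forall i p, (i <= n)%N -> U i p -> d p <= 2 ^- i.+1 &
        forall i p, (i <= n)%N -> d p < 2 ^- i.+1 -> U i p].
Proof.
pose g := dyadic_cost R U n; have g_ge0 : forall p, 0 <= g p.
  exact: dyadic_cost_ge0.
have d_le p : chain_dist g p <= g p.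
  case: p => x y; rewrite -[leRHS]addr0.
  exact: (chain_dist_le g_ge0 x [:: y]).
exists (chain_dist g); split.
- exact: (chain_dist_pseudo_metric g_ge0 (dyadic_cost_sym R n U_sym)).
- move=> p; apply: le_trans (d_le p) _; rewrite /g /dyadic_cost.
  case: asboolP => // _; rewrite -[leRHS]invr1 -(expr0 (2 : R)).
  by apply: bigmax_le => *; apply: exp2V_le.
- move=> i p le_in Uip; apply: le_trans (d_le p) _.
  exact: dyadic_cost_le.
move=> i [x y] le_in d_lt; apply: (dyadic_cost_lt (R := R) U_diag le_in).
rewrite -exp2V_double; apply: le_lt_trans (_ : _ <= 2 * chain_dist g (x, y)) _.
  rewrite mulrC -ler_pdivrMr //; apply: le_chain_dist => s <-.
  rewrite ler_pdivrMr // mulrC; apply: cost_le_double_path_length => //.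
    by move=> u; rewrite /g /dyadic_cost asboolT.
  exact: dyadic_cost_three.
by rewrite ltr_pM2l.
Qed.

(** * Comparison with powers of two *)

Lemma natr_cell (R : realType) (k : nat) (t : R) :
  0 < t -> t <= k%:R -> exists2 i, (i < k)%N & i%:R < t <= i.+1%:R.
Proof.
elim: k => [|k IHk] t_gt0 t_le; first by lra.
have [t_le_k|k_lt_t] := leP t k%:R; last by exists k; rewrite ?k_lt_t.
by have [i lt_ik ti] := IHk t_gt0 t_le_k; exists i => //; exact: ltnW.
Qed.

Lemma powR2N_cell (R : realType) (i : nat) (t : R) :
  i%:R < t <= i.+1%:R -> 2 ^- i.+1 <= (2 : R) `^ (- t) < 2 ^- i.
Proof.
move=> /andP[it ti]; rewrite !powRN -!powR_mulrn //.
rewrite lef_pV2 ?ltf_pV2 ?posrE ?powR_gt0 // ler_powR ?ler1n //=.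
by rewrite /powR !pnatr_eq0 /= ltr_expR ltr_pM2r // ln_gt0 // ltr1n.
Qed.

Lemma delta_image (R : realType) (X : Type) (K : X * X -> R) (k : nat)
    (f : R -> R) p t :
  {in `[0, k%:R] &, {homo f : s t / s < t}} -> t \in `[0, k%:R] ->
  f t = K p -> delta K k f p = 2 `^ (- t).
Proof.
move=> f_incr t_in ftK; rewrite /delta -ftK pinvKV ?inE //.
move=> u v; rewrite !inE => u_in v_in fuv.
by apply/eqP; case: ltgtP => // /f_incr; rewrite fuv ltxx => ->.
Qed.

Theorem theorem3 (R : realType) (X : Type) (K : X * X -> R)
  (K_ge0 : forall x y, 0 <= K (x, y))
  (K_sym : forall x y, K (x, y) = K (y, x))
  (K_diag : forall x, (K (x, x))%:E = ereal_sup (range (fun y => (K (x, y))%:E)))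
  (Linf_gt0 : (0 < Lambda_infty K)%E)
  (Lam : R) (Lam_gt0 : 0 < Lam) (Lam_lt : (Lam%:E < Lambda_infty K)%E)
  (k : nat) (k_ge1 : (1 <= k)%N)
  (lam : nat -> R)
  (lam0 : lam 0%N = 0)
  (lamk : lam k = Lam)
  (lam_incr : forall i, (i < k)%N -> lam i < lam i.+1)
  (lam_comp : forall i, (1 <= i <= k)%N ->
     comp_power (superlevel K (lam i)) 3 `<=` superlevel K (lam i.-1))
  (lam_diag : forall i, (i <= k)%N -> diagonal `<=` superlevel K (lam i)) :
  exists d : X * X -> R,
    [/\ pseudo_metric d,
        forall i, (1 <= i <= k)%N ->
          superlevel K (lam i) `<=` sublevel d (2 ^- i) /\
          sublevel d (2 ^- i) `<=` superlevel K (lam i.-1) &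
        forall f : R -> R,
          f @` `[0, k%:R] `<=` `[0, Lam] ->
          {in `[0, k%:R] &, {homo f : s t / s < t}} ->
          (forall i, (i <= k)%N -> f i%:R = lam i) ->
          forall x y, (f @` `[0, k%:R]) (K (x, y)) ->
            delta K k f (x, y) / 4 < d (x, y) /\
            d (x, y) <= 2 * delta K k f (x, y)].
Proof.
pose U i := superlevel K (lam i).
have U_sym i x y : U i (x, y) -> U i (y, x) by rewrite /U /superlevel /= K_sym.
have U_comp i : (i < k)%N -> comp_power (U i.+1) 3 `<=` U i.
  by move=> lt_ik; apply: (lam_comp i.+1).
have [d [d_pm d_le1 d_le d_lt]] := finite_metrization R U_sym lam_diag U_comp.
exists d; split=> //.
  case=> // i /= le_ik; split=> p.
    move=> /(d_le _ _ le_ik) /le_lt_trans; apply.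
    by rewrite -[ltRHS]exp2V_double ltr_pMl ?exp2V_gt0 // ltr1n.
  exact: d_lt (ltnW le_ik).
move=> f _ f_incr f_lam x y [t t_in ftK].
rewrite (delta_image f_incr t_in ftK).
have nat_in i : (i <= k)%N -> i%:R \in `[0 : R, k%:R].
  by move=> le_ik; rewrite in_itv /= ler0n ler_nat.
have outside i : (i <= k)%N -> t <= i%:R -> 2 ^- i.+1 <= d (x, y).
  move=> le_ik ti; rewrite leNgt; apply/negP => /(d_lt _ _ le_ik).
  rewrite /U /superlevel /= -ftK -f_lam // ltNge.
  move: ti; rewrite le_eqVlt => /predU1P[->|ti]; first by rewrite lexx.
  by rewrite ltW // f_incr // nat_in.
have [t_eq0|t_neq0] := eqVneq t 0.
  have := outside 0%N (leq0n k); rewrite t_eq0 lexx => /(_ isT).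
  by rewrite oppr0 powRr0; have := d_le1 (x, y); lra.
have /andP[t_ge0 t_le] : 0 <= t <= k%:R by move: t_in; rewrite /= in_itv.
have [|i lt_ik cell] := natr_cell _ t_le; first by rewrite lt_def t_neq0.
have /andP[it ti] := cell; have /andP[delta_ge delta_lt] := powR2N_cell cell.
have d_ge := outside i.+1 lt_ik ti.
have : d (x, y) <= 2 ^- i.+1.
  apply: (d_le _ _ (ltnW lt_ik)); rewrite /U /superlevel /= -ftK.
  by rewrite -f_lam ?(ltnW lt_ik) // f_incr // nat_in // ltnW.
have := exp2V_double R i; have := exp2V_double R i.+1.
have := exp2V_gt0 R i.+2.
by split; lra.
Qed.
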